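(* Let $R$ and $S$ be associative rings with unit, where $R$ is a finite ring. The categories $\textup{mod-}R$ and $\textup{mod-}S$ are elementarily equivalent if and only if they are Morita-equivalent (i.e., equivalent as categories).
   Context: The ambient set theory is NBG (von Neumann--Bernays--G\''odel, with choice). $\textup{mod-}R$ is the category of all left $R$-modules and all homomorphisms. The first order language of category theory has variables for objects and for morphisms, equality, and expressions for ''$f\in \mathrm{Mor}(X,Y)$'', ''$h=f\circ g$'' and ''$f=1_X$''. Two categories are elementarily equivalent if the same sentences of this language hold in both. *)

(* Defs.v *)
From HB Require Import structures.
From mathcomp Require Import all_boot all_order all_algebra.
From mathcomp Require Import boolp.

Set Implicit Arguments.
Unset Strict Implicit.
Unset Printing Implicit Defensive.

Import GRing.Theory.

(* [compm g f] is "g after f". *)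
Record category := Category {
  ob : Type;
  hom : ob -> ob -> Type;
  idm : forall X, hom X X;
  compm : forall X Y Z, hom Y Z -> hom X Y -> hom X Z;
  comp1m : forall X Y (f : hom X Y), compm (idm Y) f = f;
  compm1 : forall X Y (f : hom X Y), compm f (idm X) = f;
  compmA : forall W X Y Z (h : hom Y Z) (g : hom X Y) (f : hom W X),
    compm h (compm g f) = compm (compm h g) f }.

Arguments hom {c} X Y.
Arguments idm {c} X.
Arguments compm {c X Y Z} g f.

Record functor (C D : category) := Functor {
  fob : ob C -> ob D;
  fhom : forall X Y, hom X Y -> hom (fob X) (fob Y);
  fhom1 : forall X, fhom (idm X) = idm (fob X);
  fhomM : forall X Y Z (g : hom Y Z) (f : hom X Y),
    fhom (compm g f) = compm (fhom g) (fhom f) }.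

Arguments fob {C D} _ X.
Arguments fhom {C D} _ {X Y} _.

Definition functor_id (C : category) : functor C C :=
  @Functor C C (fun X => X) (fun X Y f => f)
    (fun X => erefl) (fun X Y Z g f => erefl).

Lemma functor_comp1 (C D E : category) (G : functor D E) (F : functor C D)
  (X : ob C) : fhom G (fhom F (idm X)) = idm (fob G (fob F X)).
Proof. by rewrite !fhom1. Qed.

Lemma functor_compM (C D E : category) (G : functor D E) (F : functor C D)
    (X Y Z : ob C) (g : hom Y Z) (f : hom X Y) :
  fhom G (fhom F (compm g f)) = compm (fhom G (fhom F g)) (fhom G (fhom F f)).
Proof. by rewrite !fhomM. Qed.

Definition functor_comp (C D E : category) (G : functor D E)
    (F : functor C D) : functor C E :=
  Functor (functor_comp1 G F) (@functor_compM C D E G F).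

Definition is_iso (C : category) (X Y : ob C) (f : hom X Y) : Prop :=
  exists g : hom Y X, compm g f = idm X /\ compm f g = idm Y.

Definition naturally_isomorphic (C D : category) (F G : functor C D) : Prop :=
  exists eta : forall X : ob C, hom (fob F X) (fob G X),
    (forall X, is_iso (eta X)) /\
    (forall (X Y : ob C) (f : hom X Y),
       compm (eta Y) (fhom F f) = compm (fhom G f) (eta X)).

Definition equivalent_categories (C D : category) : Prop :=
  exists (F : functor C D) (G : functor D C),
    naturally_isomorphic (functor_comp G F) (functor_id C) /\
    naturally_isomorphic (functor_comp F G) (functor_id D).

(* The morphisms of a category as a single sort: every morphism carries its
   source and target, so distinct hom-sets are disjoint. *)
Record mor (C : category) := Mor {
  mor_src : ob C;
  mor_tgt : ob C;
  mor_hom : hom mor_src mor_tgt }.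

Arguments Mor {C mor_src mor_tgt} mor_hom.

(* [formula A B]: formulas whose free object variables are named by [A] and
   whose free morphism variables are named by [B].  A quantifier binds the
   variable [None] of its scope. *)
Inductive formula (A B : Type) : Type :=
| EqOb (x y : A)
| EqMor (f g : B)
| InMor (f : B) (x y : A)
| IsComp (h f g : B)
| IsId (f : B) (x : A)
| Neg (phi : formula A B)
| And (phi psi : formula A B)
| Or (phi psi : formula A B)
| Imp (phi psi : formula A B)
| AllOb (phi : formula (option A) B)
| ExOb (phi : formula (option A) B)
| AllMor (phi : formula A (option B))
| ExMor (phi : formula A (option B)).

Definition sentence := formula void void.

Definition extend (A T : Type) (e : A -> T) (t : T) (a : option A) : T :=
  if a is Some a' then e a' else t.

Fixpoint sat (C : category) (A B : Type) (phi : formula A B)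
    (eo : A -> ob C) (em : B -> mor C) {struct phi} : Prop :=
  match phi with
  | EqOb x y => eo x = eo y
  | EqMor f g => em f = em g
  | InMor f x y => exists u : hom (eo x) (eo y), em f = Mor u
  | IsComp h f g =>
      exists (X Y Z : ob C) (u : hom Y Z) (v : hom X Y),
        [/\ em f = Mor u, em g = Mor v & em h = Mor (compm u v)]
  | IsId f x => em f = Mor (idm (eo x))
  | Neg p => ~ sat p eo em
  | And p q => sat p eo em /\ sat q eo em
  | Or p q => sat p eo em \/ sat q eo em
  | Imp p q => sat p eo em -> sat q eo em
  | AllOb p => forall X : ob C, sat p (extend eo X) em
  | ExOb p => exists X : ob C, sat p (extend eo X) em
  | AllMor p => forall f : mor C, sat p eo (extend em f)
  | ExMor p => exists f : mor C, sat p eo (extend em f)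
  end.

Definition holds (C : category) (phi : sentence) : Prop :=
  sat phi (of_void (ob C)) (of_void (mor C)).

Definition elementarily_equivalent (C D : category) : Prop :=
  forall phi : sentence, holds C phi <-> holds D phi.

Section ModuleCategory.
Variable R : pzRingType.

Lemma linear_ext (M N : lmodType R) (f g : {linear M -> N}) :
  f =1 g -> f = g.
Proof.
case: f g => f [[[f0 fD]] [sf]] [g [[[g0 gD]] [sg]]] /= /funext fg.
case: g / fg g0 gD sg => g0 gD sg.
by rewrite (Prop_irrelevance f0 g0) (Prop_irrelevance fD gD)
  (Prop_irrelevance sf sg).
Qed.

Definition lin_id (M : lmodType R) : {linear M -> M} := idfun.

Definition lin_comp (M N P : lmodType R) (g : {linear N -> P})
  (f : {linear M -> N}) : {linear M -> P} := g \o f.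

Lemma lin_comp1m (M N : lmodType R) (f : {linear M -> N}) :
  lin_comp (lin_id N) f = f.
Proof. exact: linear_ext. Qed.

Lemma lin_compm1 (M N : lmodType R) (f : {linear M -> N}) :
  lin_comp f (lin_id M) = f.
Proof. exact: linear_ext. Qed.

Lemma lin_compA (L M N P : lmodType R) (h : {linear N -> P})
    (g : {linear M -> N}) (f : {linear L -> M}) :
  lin_comp h (lin_comp g f) = lin_comp (lin_comp h g) f.
Proof. exact: linear_ext. Qed.

(* Equality of objects is Leibniz equality of [lmodType R] structures, which
   includes the choice operator of the carrier; it is strictly finer than
   isomorphism, and every isomorphism class is infinite, as it is for modules
   carried by sets. *)
Definition module_category : category :=
  @Category (lmodType R) (fun M N => {linear M -> N}) lin_id lin_comp
    lin_comp1m lin_compm1 lin_compA.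

End ModuleCategory.

(* Main.v *)
Require Import Defs.
From HB Require Import structures.
From Stdlib Require List.
From mathcomp Require Import all_boot all_order all_algebra.
From mathcomp Require Import boolp.
Import Defs.

(* In mod-R there is a projective generator P whose endomorphism ring is opposite
   to R, and since R is finite a single sentence says so, addition being read off
   a biproduct P + P.  If mod-S satisfies that sentence, let P be such an
   S-module.  The trace ideal of a generator is S, so 1 is a finite sum of values
   g_j(q_j) with g_j : P -> S, and x = sum_j (g_j(-) x)(q_j) shows that the q_j
   generate P over its finite endomorphism ring.  So P is finite, hence a finitely
   generated projective generator, and Hom_S(P, -) is an equivalence whose inverse
   Hom_R(Hom_S(P, S), -) needs no tensor product.

   Conversely, an equivalence of categories preserves everything but equality of
   objects.  All isomorphism classes of modules are infinite, so that the
   duplicator wins every finite Ehrenfeucht-Fraisse game by answering with fresh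
   isomorphic copies. *)

Set Implicit Arguments.
Unset Strict Implicit.
Unset Printing Implicit Defensive.

Import GRing.Theory.

(** * Back-and-forth along a span of categories *)

(** A morphism is encoded as a dependent pair over its source and target. Equality of pairs gives
    equality up to transport along a loop, and that loop is [erefl] by proof irrelevance. *)
Lemma Mor_inj (C : category) (X Y : ob C) (u v : hom X Y) :
  Mor u = Mor v -> u = v.
Proof.
pose e (m : mor C) := existT (fun p : ob C * ob C => hom p.1 p.2)
  (mor_src m, mor_tgt m) (mor_hom m).
move=> /(congr1 e) uv; have := projT2_eq uv.
by rewrite (Prop_irrelevance (projT1_eq uv) erefl).
Qed.

Lemma MorP (C : category) (m : mor C) (X Y : ob C) :
  (exists u : hom X Y, m = Mor u) <-> mor_src m = X /\ mor_tgt m = Y.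
Proof.
split=> [[u ->] //|]; case: m => X' Y' u /= [? ?]; subst X' Y'.
by exists u.
Qed.

Lemma sat_IsComp (C : category) (A B : Type) (eo : A -> ob C) (em : B -> mor C)
    (h f g : B) (X Y Z : ob C) (u : hom Y Z) (v : hom X Y) (w : hom X Z) :
  em h = Mor w -> em f = Mor u -> em g = Mor v ->
  sat (IsComp A h f g) eo em <-> w = compm u v.
Proof.
move=> hE fE gE /=; rewrite hE fE gE; split; last first.
  by move=> ->; exists X, Y, Z, u, v.
case=> X' [Y' [Z' [u' [v']]]] [eu ev ew].
have /= eX := congr1 (@mor_src _) ev; have /= eY := congr1 (@mor_src _) eu.
have /= eZ := congr1 (@mor_tgt _) eu; subst X' Y' Z'.
by rewrite (Mor_inj eu) (Mor_inj ev); apply: Mor_inj ew.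
Qed.

Lemma sat_IsComp_typed (C : category) (A B : Type) (eo : A -> ob C)
    (em : B -> mor C) (h f g : B) :
  sat (IsComp A h f g) eo em ->
  [/\ mor_src (em h) = mor_src (em g), mor_src (em f) = mor_tgt (em g)
    & mor_tgt (em h) = mor_tgt (em f)].
Proof. by move=> /= [X [Y [Z [u [v [-> -> ->]]]]]]. Qed.

Definition mor_map (K C : category) (E : functor K C) (m : mor K) : mor C :=
  Mor (fhom E (mor_hom m)).

Definition faithful (K C : category) (E : functor K C) : Prop :=
  forall (X Y : ob K) (u v : hom X Y), fhom E u = fhom E v -> u = v.

Definition full (K C : category) (E : functor K C) : Prop :=
  forall (X Y : ob K) (v : hom (fob E X) (fob E Y)), exists u, fhom E u = v.

Section Span.
Variables (K : category).

(** The language can compare objects, while the legs of the span may identify some. Injectivity is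
    therefore demanded only on the objects played so far. *)
Definition inj_on (C : category) (E : functor K C) (s : seq (ob K)) : Prop :=
  forall x y, List.In x s -> List.In y s -> fob E x = fob E y -> x = y.

Definition mor_on (s : seq (ob K)) (m : mor K) : Prop :=
  List.In (mor_src m) s /\ List.In (mor_tgt m) s.

Section Embedding.
Variables (C : category) (E : functor K C) (s : seq (ob K)).
Hypotheses (Ef : faithful E) (Ei : inj_on E s).

Lemma mor_map_inj (m n : mor K) : mor_on s m -> mor_on s n ->
  mor_map E m = mor_map E n -> m = n.
Proof.
case: m n => [X Y u] [X' Y' v] [/= sX sY] [/= sX' sY'] e.
have /= /(Ei sX sX') eX := congr1 (@mor_src _) e.
have /= /(Ei sY sY') eY := congr1 (@mor_tgt _) e.
by subst X' Y'; congr Mor; exact: Ef (Mor_inj e).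
Qed.

Variables (A B : Type) (eo : A -> ob K) (em : B -> mor K).
Hypotheses (eos : forall a, List.In (eo a) s) (ems : forall b, mor_on s (em b)).

Let Eo a := fob E (eo a).
Let Em b := mor_map E (em b).

Lemma embed_EqOb x y : sat (EqOb B x y) Eo Em <-> sat (EqOb B x y) eo em.
Proof. by split=> /= [/Ei|e]; [apply; apply: eos | rewrite /Eo e]. Qed.

Lemma embed_EqMor f g : sat (EqMor A f g) Eo Em <-> sat (EqMor A f g) eo em.
Proof. by split=> /= [/mor_map_inj|e]; [apply; apply: ems | rewrite /Em e]. Qed.

Lemma embed_InMor f x y : sat (InMor f x y) Eo Em <-> sat (InMor f x y) eo em.
Proof.
rewrite /= !MorP /Em /Eo /=; have [sf tf] := ems f.
split=> -[e1 e2]; last by rewrite e1 e2.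
by split; [apply: Ei e1 | apply: Ei e2].
Qed.

Lemma embed_IsId f x : sat (IsId f x) Eo Em <-> sat (IsId f x) eo em.
Proof.
have e : Mor (idm (Eo x)) = mor_map E (Mor (idm (eo x))).
  by rewrite /mor_map /= fhom1.
rewrite /= e; split=> [/mor_map_inj|fE]; last by rewrite /Em fE.
by apply; [apply: ems | split; apply: eos].
Qed.

Lemma embed_IsComp h f g :
  sat (IsComp A h f g) Eo Em <-> sat (IsComp A h f g) eo em.
Proof.
have EmE b X Y (u : hom X Y) : em b = Mor u -> Em b = Mor (fhom E u).
  by rewrite /Em => ->.
split=> sc; last first.
  case: sc => X [Y [Z [u [v [fE gE hE]]]]].
  exact/(sat_IsComp Eo
    (EmE _ _ _ _ hE) (EmE _ _ _ _ fE) (EmE _ _ _ _ gE))/fhomM.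
(* The arrows are so far composable only after applying [E]. Injectivity on [s] pulls the three
   equations between sources and targets back to [K], and faithfulness then reflects the
   composite. *)
case: (sat_IsComp_typed sc) => /= e1 e2 e3.
have [[sh th] [sf tf] [sg tg]] := And3 (ems h) (ems f) (ems g).
move/(Ei sh sg): e1 => e1; move/(Ei sf tg): e2 => e2.
move/(Ei th tf): e3 => e3; move: sc.
case hE: (em h) e1 e3 => [X Z w]; case fE: (em f) e2 => [Y' Z' u].
case gE: (em g) => [X' Y v] /= ? ? ?; subst X' Y' Z'.
move=> sc; suff -> : w = compm u v by exists X, Y, Z, u, v.
apply: Ef.
rewrite fhomM.
exact: (iffLR (sat_IsComp Eo
  (EmE _ _ _ _ hE) (EmE _ _ _ _ fE) (EmE _ _ _ _ gE)) sc).
Qed.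

End Embedding.

(** The duplicator's resource: an object of [C] can be lifted so that the answer in [D] avoids
    finitely many earlier answers. *)
Definition extensible (C D : category) (E : functor K C) (E' : functor K D) :=
  forall (X : ob C) (l : seq (ob D)),
    exists t : ob K, fob E t = X /\ ~ List.In (fob E' t) l.

(** If [X] has been played already, the old answer is repeated; otherwise a lift with a fresh second
    image keeps both legs injective. *)
Lemma extend_inj (C D : category) (E : functor K C) (E' : functor K D)
    (s : seq (ob K)) (X : ob C) :
  extensible E E' -> inj_on E s -> inj_on E' s ->
  exists t s', [/\ fob E t = X, List.In t s', List.incl s s', inj_on E s'
    & inj_on E' s'].
Proof.
move=> ext iE iE'.
have [[t [ts tX]]|nX] := pselect (exists t, List.In t s /\ fob E t = X).
  by exists t, s; split=> // x.
have [t [tX tl]] := ext X (List.map (fob E') s).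
exists t, (t :: s); split=> //; [by left | by move=> x; right | |].
  move=> x y [<-|xs] [<-|ys] // e; last exact: iE.
    by case: nX; exists y; rewrite -e.
  by case: nX; exists x; rewrite e.
move=> x y [<-|xs] [<-|ys] // e; last exact: iE'.
  by case: tl; rewrite e; apply: List.in_map.
by case: tl; rewrite -e; apply: List.in_map.
Qed.

(** A morphism move is answered by first playing its source and its target, then lifting the arrow
    by fullness. *)
Lemma extend_inj_mor (C D : category) (E : functor K C) (E' : functor K D)
    (s : seq (ob K)) (f : mor C) :
  extensible E E' -> full E -> inj_on E s -> inj_on E' s ->
  exists m s', [/\ mor_map E m = f, mor_on s' m, List.incl s s', inj_on E s'
    & inj_on E' s'].
Proof.
move=> ext fu iE iE'; case: f => X Y u.
have [x [s1 [xX xs1 ss1 iE1 iE1']]] := extend_inj X ext iE iE'.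
have [y [s2 [yY ys2 ss2 iE2 iE2']]] := extend_inj Y ext iE1 iE1'.
subst X Y; have [v <-] := fu _ _ u.
exists (Mor v), s2; split=> //; first by split=> //; apply: ss2.
by move=> z /ss1 /ss2.
Qed.

Lemma extend_comp (A S T : Type) (h : S -> T) (e : A -> S) (t : S) :
  extend (fun a => h (e a)) (h t) = (fun a => h (extend e t a)).
Proof. by apply/funext => -[]. Qed.

Section BackAndForth.
Variables (C D : category) (E : functor K C) (E' : functor K D).

Definition transfers (A B : Type) (phi : formula A B) : Prop :=
  forall (eo : A -> ob K) (em : B -> mor K) s,
    (forall a, List.In (eo a) s) -> (forall b, mor_on s (em b)) ->
    inj_on E s -> inj_on E' s ->
    sat phi (fun a => fob E (eo a)) (fun b => mor_map E (em b)) <->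
    sat phi (fun a => fob E' (eo a)) (fun b => mor_map E' (em b)).

Section Extension.
Variables (A B : Type) (eo : A -> ob K) (em : B -> mor K) (s s' : seq (ob K)).
Hypotheses (eos : forall a, List.In (eo a) s) (ems : forall b, mor_on s (em b)).
Hypotheses (ss' : List.incl s s') (iE : inj_on E s') (iE' : inj_on E' s').

Lemma transfers_extend_ob (phi : formula (option A) B) t :
  transfers phi -> List.In t s' ->
  sat phi (extend (fun a => fob E (eo a)) (fob E t))
    (fun b => mor_map E (em b)) <->
  sat phi (extend (fun a => fob E' (eo a)) (fob E' t))
    (fun b => mor_map E' (em b)).
Proof.
move=> tr ts'; rewrite !extend_comp; apply: (tr _ _ s') => //.
  by case=> [a|] /=; [apply: ss'|].
by move=> b; have [? ?] := ems b; split; apply: ss'.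
Qed.

Lemma transfers_extend_mor (phi : formula A (option B)) t :
  transfers phi -> mor_on s' t ->
  sat phi (fun a => fob E (eo a))
    (extend (fun b => mor_map E (em b)) (mor_map E t)) <->
  sat phi (fun a => fob E' (eo a))
    (extend (fun b => mor_map E' (em b)) (mor_map E' t)).
Proof.
move=> tr ts'; rewrite !extend_comp; apply: (tr _ _ s') => //.
  by move=> a; apply: ss'.
by case=> [b|] //=; have [? ?] := ems b; split; apply: ss'.
Qed.

End Extension.

Hypotheses (Ef : faithful E) (Efu : full E).
Hypotheses (Ef' : faithful E') (Efu' : full E').
Hypotheses (ext : extensible E E') (ext' : extensible E' E).

(* The position of the game is the finite list [s], on which both legs of the
   span are injective on objects. *)
Lemma span_transfers (A B : Type) (phi : formula A B) : transfers phi.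
Proof.
elim: phi => {A B}.
- by move=> A B x y eo em s eos ems i i'; rewrite !(@embed_EqOb _ _ s).
- by move=> A B f g eo em s eos ems i i'; rewrite !(@embed_EqMor _ _ s).
- by move=> A B f x y eo em s eos ems i i'; rewrite !(@embed_InMor _ _ s).
- by move=> A B h f g eo em s eos ems i i'; rewrite !(@embed_IsComp _ _ s).
- by move=> A B f x eo em s eos ems i i'; rewrite !(@embed_IsId _ _ s).
- by move=> A B p IH eo em s *; rewrite /= (IH _ _ s).
- by move=> A B p IHp q IHq eo em s *; rewrite /= (IHp _ _ s) // (IHq _ _ s).
- by move=> A B p IHp q IHq eo em s *; rewrite /= (IHp _ _ s) // (IHq _ _ s).
- by move=> A B p IHp q IHq eo em s *; rewrite /= (IHp _ _ s) // (IHq _ _ s).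
- move=> A B p IH eo em s eos ems i i' /=; split=> h X.
    (* The object to be answered lies in [D] here, so the two legs exchange roles. *)
    have [t [s' [<- ts' ss' i1 i2]]] := extend_inj X ext' i' i.
    exact/(transfers_extend_ob eos ems ss' i2 i1 IH ts').
  have [t [s' [<- ts' ss' i1 i2]]] := extend_inj X ext i i'.
  exact/(transfers_extend_ob eos ems ss' i1 i2 IH ts').
- move=> A B p IH eo em s eos ems i i' /=; split=> -[X].
    have [t [s' [<- ts' ss' i1 i2]]] := extend_inj X ext i i'.
    move/(transfers_extend_ob eos ems ss' i1 i2 IH ts') => h.
    by exists (fob E' t); apply: h.
  have [t [s' [<- ts' ss' i1 i2]]] := extend_inj X ext' i' i.
  move/(transfers_extend_ob eos ems ss' i2 i1 IH ts') => h.
  by exists (fob E t); apply: h.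
- move=> A B p IH eo em s eos ems i i' /=; split=> h f.
    have [t [s' [<- ts' ss' i1 i2]]] := extend_inj_mor f ext' Efu' i' i.
    exact/(transfers_extend_mor eos ems ss' i2 i1 IH ts').
  have [t [s' [<- ts' ss' i1 i2]]] := extend_inj_mor f ext Efu i i'.
  exact/(transfers_extend_mor eos ems ss' i1 i2 IH ts').
- move=> A B p IH eo em s eos ems i i' /=; split=> -[f].
    have [t [s' [<- ts' ss' i1 i2]]] := extend_inj_mor f ext Efu i i'.
    move/(transfers_extend_mor eos ems ss' i1 i2 IH ts') => h.
    by exists (mor_map E' t); apply: h.
  have [t [s' [<- ts' ss' i1 i2]]] := extend_inj_mor f ext' Efu' i' i.
  move/(transfers_extend_mor eos ems ss' i2 i1 IH ts') => h.
  by exists (mor_map E t); apply: h.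
Qed.

Theorem span_elementarily_equivalent : elementarily_equivalent C D.
Proof.
move=> phi; rewrite /holds.
have v (T : Type) (f g : void -> T) : f = g by apply/funext => -[].
rewrite (v _ (of_void (ob C)) (fun a => fob E (of_void (ob K) a))).
rewrite (v _ (of_void (mor C)) (fun a => mor_map E (of_void (mor K) a))).
rewrite (v _ (of_void (ob D)) (fun a => fob E' (of_void (ob K) a))).
rewrite (v _ (of_void (mor D)) (fun a => mor_map E' (of_void (mor K) a))).
by apply: (@span_transfers _ _ phi _ _ [::]) => // -[].
Qed.

End BackAndForth.

End Span.

(** * Equivalent categories with infinite isomorphism classes *)

Lemma iso_cancell (C : category) (W X Y : ob C) (f : hom X Y) (u v : hom W X) :
  is_iso f -> compm f u = compm f v -> u = v.
Proof. by case=> g [gf _] e; rewrite -[u]comp1m -[v]comp1m -gf -!compmA e. Qed.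

Lemma iso_cancelr (C : category) (X Y Z : ob C) (f : hom X Y) (u v : hom Y Z) :
  is_iso f -> compm u f = compm v f -> u = v.
Proof. by case=> g [_ fg] e; rewrite -[u]compm1 -[v]compm1 -fg !compmA e. Qed.

Lemma iso_inv (C : category) (X Y : ob C) (f : hom X Y) :
  is_iso f ->
  exists2 g : hom Y X, is_iso g & compm g f = idm X /\ compm f g = idm Y.
Proof. by case=> g [gf fg]; exists g => //; exists f. Qed.

Lemma iso_comp (C : category) (X Y Z : ob C) (g : hom Y Z) (f : hom X Y) :
  is_iso g -> is_iso f -> is_iso (compm g f).
Proof.
case=> g' [g'g gg'] [f' [f'f ff']]; exists (compm f' g').
by split; rewrite -compmA; [rewrite (compmA g') g'g|rewrite (compmA f) ff'];
  rewrite comp1m.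
Qed.

Lemma functor_iso (C D : category) (F : functor C D) (X Y : ob C)
  (f : hom X Y) : is_iso f -> is_iso (fhom F f).
Proof.
by case=> g [gf fg]; exists (fhom F g); rewrite -!fhomM gf fg !fhom1.
Qed.

(** By naturality [u] composed with [eta X] is determined by [G (F u)], and [eta X] can be
    cancelled. *)
Lemma retract_faithful (C D : category) (F : functor C D) (G : functor D C) :
  naturally_isomorphic (functor_comp G F) (functor_id C) -> faithful F.
Proof.
case=> eta [iso nat] X Y u v uv.
apply: (iso_cancelr (iso X)); have /= <- := nat _ _ u; rewrite uv.
exact: nat.
Qed.

(** Conjugating [G v] by [eta] gives an arrow [u] with [G (F u) = G v]; as [G] is faithful too,
    [F u = v]. *)
Lemma equivalence_full (C D : category) (F : functor C D) (G : functor D C) :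
  naturally_isomorphic (functor_comp G F) (functor_id C) ->
  naturally_isomorphic (functor_comp F G) (functor_id D) -> full F.
Proof.
move=> [eta [iso nat]] /retract_faithful Gf X Y v.
have [g _ [gK etaK]] := iso_inv (iso X).
exists (compm (eta Y) (compm (fhom G v) g)); apply: Gf.
apply: (iso_cancell (iso Y)); rewrite /= [LHS]nat /= -!compmA.
by rewrite gK compm1.
Qed.

Definition roomy (C : category) : Prop :=
  forall (X : ob C) (l : seq (ob C)),
    exists Y : ob C, ~ List.In Y l /\ exists f : hom X Y, is_iso f.

Section Links.
Variables (C D : category) (F : functor C D).

(** The apex of the span: an object of [C], an object of [D] and an isomorphism matching them
    through [F]. One object may occur in many links, which leaves the freedom to choose fresh copies
    on either side. *)
Record link := Link {
  link_src : ob C;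
  link_tgt : ob D;
  link_hom : hom (fob F link_src) link_tgt;
  link_inv : hom link_tgt (fob F link_src);
  link_homK : compm link_inv link_hom = idm _;
  link_invK : compm link_hom link_inv = idm _ }.

Definition link_category : category :=
  @Category link (fun s t => hom (link_src s) (link_src t))
    (fun s => idm (link_src s)) (fun r s t g f => compm g f)
    (fun s t f => comp1m f) (fun s t f => compm1 f)
    (fun q r s t h g f => compmA h g f).

Definition link_left : functor link_category C :=
  @Functor link_category C link_src (fun s t f => f)
    (fun s => erefl) (fun r s t g f => erefl).

Definition conj_link (s t : link) (f : hom (link_src s) (link_src t)) :
    hom (link_tgt s) (link_tgt t) :=
  compm (link_hom t) (compm (fhom F f) (link_inv s)).

Lemma conj_link1 (s : link) : conj_link (idm (link_src s)) = idm (link_tgt s).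
Proof. by rewrite /conj_link fhom1 comp1m link_invK. Qed.

Lemma conj_linkM (r s t : link) (g : hom (link_src s) (link_src t))
    (f : hom (link_src r) (link_src s)) :
  conj_link (compm g f) = compm (conj_link g) (conj_link f).
Proof.
rewrite /conj_link fhomM -!compmA; congr (compm _ (compm _ _)).
by rewrite [in RHS]compmA link_homK comp1m.
Qed.

Definition link_right : functor link_category D :=
  @Functor link_category D link_tgt conj_link conj_link1 conj_linkM.

Lemma link_left_faithful : faithful link_left. Proof. by []. Qed.

Lemma link_left_full : full link_left. Proof. by move=> X Y v; exists v. Qed.

Lemma link_conjK (s t : link) (f : hom (link_src s) (link_src t)) :
  compm (link_inv t) (compm (conj_link f) (link_hom s)) = fhom F f.
Proof.
rewrite /conj_link -!compmA link_homK compm1 compmA link_homK.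
by rewrite comp1m.
Qed.

Lemma link_right_faithful : faithful F -> faithful link_right.
Proof.
by move=> Ff s t u v /= e; apply: Ff; rewrite -(link_conjK u) e link_conjK.
Qed.

Lemma link_right_full : full F -> full link_right.
Proof.
move=> Ffull s t v.
have [u uE] := Ffull _ _ (compm (link_inv t) (compm v (link_hom s))).
exists u; rewrite /= /conj_link uE -!compmA link_invK compm1.
by rewrite compmA link_invK comp1m.
Qed.

Lemma link_of_iso (X : ob C) (Y : ob D) (f : hom (fob F X) Y) :
  is_iso f -> exists t : link, link_src t = X /\ link_tgt t = Y.
Proof. by case=> g [gf fg]; exists (Link gf fg). Qed.

Lemma link_left_extensible : roomy D -> extensible link_left link_right.
Proof.
move=> rD X l; have [Y [Yl [f /link_of_iso[t [tX tY]]]]] := rD (fob F X) l.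
by exists t; rewrite /= tX tY.
Qed.

(** Some [X0] has [F X0] isomorphic to [Y]; replacing [X0] by a fresh isomorphic [X] preserves this,
    since [F] preserves isomorphisms. *)
Lemma link_right_extensible : roomy C ->
  (forall Y : ob D, exists (X : ob C) (f : hom (fob F X) Y), is_iso f) ->
  extensible link_right link_left.
Proof.
move=> rC Fs Y l; have [X0 [f0 f0i]] := Fs Y.
have [X [Xl [g gi]]] := rC X0 l; have [g' g'i _] := iso_inv gi.
have /link_of_iso[t [tX tY]] := iso_comp f0i (functor_iso F g'i).
by exists t; rewrite /= tX tY.
Qed.

End Links.

Theorem equivalent_elementarily_equivalent (C D : category) :
  roomy C -> roomy D ->
  equivalent_categories C D -> elementarily_equivalent C D.
Proof.
move=> rC rD [F [G [GF FG]]].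
have Ff := retract_faithful GF; have Ffull := equivalence_full GF FG.
apply: (@span_elementarily_equivalent (link_category F) C D
  (link_left F) (link_right F)).
- exact: link_left_faithful.
- exact: link_left_full.
- exact: link_right_faithful.
- exact: link_right_full.
- exact: link_left_extensible.
- apply: link_right_extensible => // Y; case: FG => eta [iso _].
  by exists (fob G Y), (eta Y); exact: iso.
Qed.

(** * Infinitely many isomorphic copies of a module *)

Section ShiftedModule.
Import Choice.InternalTheory.

(* The module [M] with a choice operator that searches [k] steps longer, so that
   [shifted k M] and [M] are isomorphic but in general distinct objects. *)
Definition shifted (R : pzRingType) (k : nat) (M : lmodType R) : Type := M.

Variables (R : pzRingType) (k : nat) (M : lmodType R).
Local Notation N := (shifted k M).

Definition shift_find (P : pred N) (n : nat) : option N :=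
  if n < k then None else find (P : pred M) (n - k).

Lemma shift_find_correct P n x : shift_find P n = Some x -> P x.
Proof. by rewrite /shift_find; case: ifP => // _; apply: correct. Qed.

Lemma shift_find_complete (P : pred N) :
  (exists x, P x) -> exists n, shift_find P n.
Proof.
move=> /(@complete M P) [n Pn]; exists (n + k).
by rewrite /shift_find ltnNge leq_addl addnK.
Qed.

Lemma shift_find_extensional (P Q : pred N) :
  P =1 Q -> shift_find P =1 shift_find Q.
Proof. by move=> PQ n; rewrite /shift_find (@extensional M P Q PQ). Qed.

HB.instance Definition _ := Equality.copy N M.
HB.instance Definition _ := hasChoice.Build N
  shift_find_correct shift_find_complete shift_find_extensional.
HB.instance Definition _ := GRing.isZmodule.Build N
  (@addrA M) (@addrC M) (@add0r M) (@addNr M).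
HB.instance Definition _ := GRing.Zmodule_isLmodule.Build R N
  (@scalerA R M) (@scale1r R M) (@scalerDr R M) (@scalerDl R M).

Definition to_shifted (x : M) : N := x.

Definition of_shifted (x : N) : M := x.

Lemma to_shifted_linear : linear to_shifted. Proof. by []. Qed.

Lemma of_shifted_linear : linear of_shifted. Proof. by []. Qed.

HB.instance Definition _ :=
  GRing.isLinear.Build R M N *:%R to_shifted to_shifted_linear.
HB.instance Definition _ :=
  GRing.isLinear.Build R N M *:%R of_shifted of_shifted_linear.

End ShiftedModule.

Section Roomy.
Import Choice.InternalTheory.
Variable R : pzRingType.

(** The least depth at which the choice operator finds any element at all. Equal objects have equal
    rank, but isomorphic ones need not, so the rank tells copies apart. *)
Definition find_rank (M : lmodType R) : nat :=
  ex_minn (@complete M predT (ex_intro _ (0 : M)%R isT)).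

Lemma find_rank_shifted k (M : lmodType R) : k <= find_rank (shifted k M).
Proof.
rewrite /find_rank; case: ex_minnP => n fn _; rewrite leqNgt; apply/negP => nk.
by move: fn; rewrite /find /= /shift_find nk.
Qed.

Lemma module_category_roomy : roomy (module_category R).
Proof.
(* The shift exceeds every rank occurring in [l], so the shifted copy cannot be listed there. *)
move=> M l; pose k := (List.list_max (List.map find_rank l)).+1.
exists (shifted k M : lmodType R); split.
  move=> /(List.in_map find_rank) Ml; have := find_rank_shifted k M.
  suff : find_rank (shifted k M) < k by rewrite ltnNge => /negbTE ->.
  rewrite ltnS; apply/leP.
  have lk := proj1 (List.list_max_le (List.map find_rank l) _) (le_n _).
  exact: (proj1 (List.Forall_forall _ _) lk _ Ml).
exists (@to_shifted R k M : {linear M -> shifted k M}).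
exists (@of_shifted R k M : {linear shifted k M -> M}).
by split; apply: linear_ext.
Qed.

End Roomy.

(** * Morita equivalence *)

Local Open Scope ring_scope.

Section LinearMaps.
Variable R : pzRingType.

Definition mk_linear (M N : lmodType R) (f : M -> N) (fl : linear f) :
  {linear M -> N} := HB.pack f (GRing.isLinear.Build R M N *:%R f fl).

Lemma module_iso (M N : lmodType R) (f : {linear M -> N}) (g : N -> M) :
  cancel f g -> cancel g f -> @is_iso (module_category R) M N f.
Proof.
move=> fK gK; have gl : linear g.
  by move=> a x y; rewrite -{1}[x]gK -{1}[y]gK -linearP fK.
exists (mk_linear gl).
by split; apply: linear_ext => x /=; rewrite ?fK ?gK.
Qed.

End LinearMaps.

Lemma naturally_isomorphic_sym (C D : category) (F G : functor C D) :
  naturally_isomorphic F G -> naturally_isomorphic G F.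
Proof.
case=> eta [iso nat].
pose inv X := cid (iso X).
exists (fun X => projT1 (inv X)); split=> [X|X Y f].
  by case: (inv X) => g /= [gf fg]; exists (eta X).
apply: (iso_cancell (iso Y)); rewrite !compmA.
case: (inv X) (inv Y) => g /= [gf fg] [h /= [hf fh]].
by rewrite fh comp1m nat -compmA fg compm1.
Qed.

(** A right action of [R] on the left [S]-module [P], which makes [P] a bimodule; hence the reversed
    order in [actM]. *)
Record raction (R S : pzRingType) (P : lmodType S) := Raction {
  act : R -> {linear P -> P};
  act1 : forall x, act 1 x = x;
  actM : forall a b x, act (a * b) x = act b (act a x);
  actD : forall a b x, act (a + b) x = act a x + act b x }.

(** The parameter [rho] does not affect the carrier; it lets inference find the left [R]-module
    structure, in which scalars act on the argument. *)
Definition hom_module (R S : pzRingType) (P : lmodType S) (rho : raction R P)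
  (M : lmodType S) : Type := {linear P -> M}.

Section HomModule.
Variables (R S : pzRingType) (P : lmodType S) (rho : raction R P).

Section Structure.
Variable M : lmodType S.
Local Notation H := (hom_module rho M).
Implicit Types h : H.

HB.instance Definition _ := gen_eqMixin H.
HB.instance Definition _ := gen_choiceMixin H.

Definition hom_app h : P -> M := h : {linear P -> M}.

Lemma hom_ext h h' : hom_app h =1 hom_app h' -> h = h'.
Proof. exact: (@linear_ext S P M h h'). Qed.

Definition hom_zero : H := (\0 : {linear P -> M}).
Definition hom_add h h' : H :=
  ((h : {linear P -> M}) \+ (h' : {linear P -> M}) : {linear P -> M}).
Definition hom_opp h : H := (\- (h : {linear P -> M}) : {linear P -> M}).
Definition hom_scale (a : R) h : H := lin_comp h (act rho a).

Lemma hom_addA : associative hom_add.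
Proof. by move=> f g h; apply: hom_ext => x; apply: addrA. Qed.
Lemma hom_addC : commutative hom_add.
Proof. by move=> f g; apply: hom_ext => x; apply: addrC. Qed.
Lemma hom_add0 : left_id hom_zero hom_add.
Proof. by move=> f; apply: hom_ext => x; apply: add0r. Qed.
Lemma hom_addN : left_inverse hom_zero hom_opp hom_add.
Proof. by move=> f; apply: hom_ext => x; apply: addNr. Qed.

HB.instance Definition _ :=
  GRing.isZmodule.Build H hom_addA hom_addC hom_add0 hom_addN.

Lemma hom_scaleA a b h : hom_scale a (hom_scale b h) = hom_scale (a * b) h.
Proof. by apply: hom_ext => x; rewrite /hom_app /= actM. Qed.
Lemma hom_scale1 : left_id 1 hom_scale.
Proof. by move=> h; apply: hom_ext => x; rewrite /hom_app /= act1. Qed.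
Lemma hom_scaleDr : right_distributive hom_scale +%R.
Proof. by move=> a f g; apply: hom_ext. Qed.
Lemma hom_scaleDl h : {morph hom_scale^~ h : a b / a + b}.
Proof.
by move=> a b; apply: hom_ext => x; rewrite /hom_app /= actD linearD.
Qed.


HB.instance Definition _ := GRing.Zmodule_isLmodule.Build R H
  hom_scaleA hom_scale1 hom_scaleDr hom_scaleDl.

Lemma hom_appZ a h x : hom_app (a *: h) x = hom_app h (act rho a x).
Proof. by []. Qed.
Lemma hom_app_linear h : linear (hom_app h).
Proof. exact: linearP. Qed.

Lemma hom_app_suml (I : Type) (r : seq I) (F : I -> H) x :
  hom_app (\sum_(i <- r) F i) x = \sum_(i <- r) hom_app (F i) x.
Proof.
by elim: r => [|i r IH]; rewrite ?big_nil // !big_cons -IH.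
Qed.

Lemma hom_app_sumr (I : Type) (r : seq I) h (F : I -> P) :
  hom_app h (\sum_(i <- r) F i) = \sum_(i <- r) hom_app h (F i).
Proof. exact: linear_sum. Qed.

Lemma hom_app_scale s h x : hom_app h (s *: x) = s *: hom_app h x.
Proof. exact: linearZ. Qed.

End Structure.

Lemma hom_post_linear (M N : lmodType S) (f : {linear M -> N}) :
  linear (fun h : hom_module rho M =>
    lin_comp f (h : {linear P -> M}) : hom_module rho N).
Proof.
by move=> a g h; apply: hom_ext => x; rewrite /hom_app /= linearD.
Qed.

Definition hom_post (M N : lmodType S) (f : {linear M -> N}) :
    {linear hom_module rho M -> hom_module rho N} :=
  mk_linear (hom_post_linear f).

Lemma hom_post1 (M : lmodType S) :
  hom_post (lin_id M) = lin_id (hom_module rho M).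
Proof. by apply: linear_ext => h; apply: hom_ext. Qed.

Lemma hom_postM (L M N : lmodType S) (g : {linear M -> N})
    (f : {linear L -> M}) :
  hom_post (lin_comp g f) = lin_comp (hom_post g) (hom_post f).
Proof. by apply: linear_ext => h; apply: hom_ext. Qed.

Definition hom_functor : functor (module_category S) (module_category R) :=
  @Functor (module_category S) (module_category R)
    (fun M => hom_module rho M) hom_post hom_post1 hom_postM.

End HomModule.

(** * The dual bimodule *)

Section Dual.
Variables (R S : pzRingType) (P : lmodType S) (rho : raction R P).

Definition dual : lmodType R := hom_module rho S^o.
Local Notation Q := dual.

Definition dual_app (f : Q) (x : P) : S := hom_app f x.

Lemma dual_app_linear f a x y :
  dual_app f (a *: x + y) = a * dual_app f x + dual_app f y.
Proof. by rewrite /dual_app hom_app_linear. Qed.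

Lemma dual_appM f a x : dual_app f (a *: x) = a * dual_app f x.
Proof. by rewrite /dual_app hom_app_scale. Qed.

Lemma dual_appD f g x : dual_app (f + g) x = dual_app f x + dual_app g x.
Proof. by []. Qed.

Lemma dual_appZ a f x : dual_app (a *: f) x = dual_app f (act rho a x).
Proof. by []. Qed.

Lemma dual_mulr_linear (s : S) (f : Q) :
  linear (fun x => dual_app f x * s : S^o).
Proof. by move=> a x y; rewrite dual_app_linear mulrDl -mulrA. Qed.

Definition dual_mulr (s : S) (f : Q) : Q := mk_linear (dual_mulr_linear s f).

Lemma dual_mulr_act_linear (s : S) : linear (dual_mulr s).
Proof.
by move=> a f g; apply: hom_ext => x; rewrite [LHS]mulrDl.
Qed.

Definition dual_act (s : S) : {linear Q -> Q} :=
  mk_linear (dual_mulr_act_linear s).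

Lemma dual_act1 f : dual_act 1 f = f.
Proof. by apply: hom_ext => x; apply: mulr1. Qed.
Lemma dual_actM a b f : dual_act (a * b) f = dual_act b (dual_act a f).
Proof. by apply: hom_ext => x; apply: mulrA. Qed.
Lemma dual_actD a b f : dual_act (a + b) f = dual_act a f + dual_act b f.
Proof. by apply: hom_ext => x; apply: mulrDr. Qed.

(** Right multiplication on values commutes with the left action of [R] on arguments, so the dual is
    an [R]-[S]-bimodule and can serve as source of the backward Hom functor. *)
Definition dual_raction : raction S Q := Raction dual_act1 dual_actM dual_actD.

End Dual.

Section Morita.
Variables (R S : pzRingType) (P : lmodType S) (rho : raction R P).
Local Notation Q := (dual rho).
Local Notation sigma := (dual_raction rho).
Local Notation F := (hom_functor rho).
Local Notation G := (hom_functor sigma).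

Hypothesis act_inj : forall a b, act rho a =1 act rho b -> a = b.
Hypothesis act_surj : forall f : {linear P -> P}, exists a, act rho a =1 f.

Variables (I J : finType).
Variables (f_ : I -> Q) (p_ : I -> P) (g_ : J -> Q) (q_ : J -> P).
(** The dual basis expresses that [P] is finitely generated projective; [trace_one] expresses that
    it is a generator. *)
Hypothesis dual_basis : forall x : P, x = \sum_i dual_app (f_ i) x *: p_ i.
Hypothesis trace_one : \sum_j dual_app (g_ j) (q_ j) = 1.

Lemma rank_one_linear (f : Q) (p : P) : linear (fun x => dual_app f x *: p).
Proof. by move=> a x y; rewrite dual_app_linear scalerDl -scalerA. Qed.

(** The second pairing of the Morita context, written [f, p] below: the ring element acting as the
    endomorphism f(-) p. The first pairing is [dual_app]. *)
Definition rank_one (f : Q) (p : P) : R :=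
  projT1 (cid (act_surj (mk_linear (rank_one_linear f p)))).

Lemma act_rank_one f p x : act rho (rank_one f p) x = dual_app f x *: p.
Proof. by rewrite /rank_one; case: cid => a /= ->. Qed.

Lemma rank_oneDl f g p : rank_one (f + g) p = rank_one f p + rank_one g p.
Proof.
by apply: act_inj => x; rewrite actD !act_rank_one dual_appD scalerDl.
Qed.

Lemma rank_oneDr f p q : rank_one f (p + q) = rank_one f p + rank_one f q.
Proof. by apply: act_inj => x; rewrite actD !act_rank_one scalerDr. Qed.

Lemma rank_oneZl a f p : rank_one (a *: f) p = a * rank_one f p.
Proof. by apply: act_inj => x; rewrite actM !act_rank_one dual_appZ. Qed.

Lemma rank_oneZr s f p : rank_one f (s *: p) = rank_one (act sigma s f) p.
Proof. by apply: act_inj => x; rewrite !act_rank_one scalerA. Qed.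

Lemma rank_one_act a f p : rank_one f (act rho a p) = rank_one f p * a.
Proof. by apply: act_inj => x; rewrite actM !act_rank_one linearZ. Qed.

(** Associativity of the Morita context: both sides send x to f(x) g(p). *)
Lemma rank_one_scale f g p : rank_one f p *: g = act sigma (dual_app g p) f.
Proof.
by apply: hom_ext => x; rewrite hom_appZ act_rank_one hom_app_scale.
Qed.

Lemma sum_rank_one : \sum_i rank_one (f_ i) (p_ i) = 1.
Proof.
apply: act_inj => x; rewrite act1 [RHS]dual_basis.
have actS (r : seq I) (a : I -> R) :
    act rho (\sum_(i <- r) a i) x = \sum_(i <- r) act rho (a i) x.
  elim: r => [|i r IH]; last by rewrite !big_cons actD IH.
  (* An action is only assumed to preserve sums, so that 0 acts as zero follows by cancellation. *)
  rewrite !big_nil; apply: (addIr (act rho 0 x)).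
  by rewrite -actD !add0r.
by rewrite actS; apply: eq_bigr => i _; rewrite act_rank_one.
Qed.

Section Evaluation.
Variable M : lmodType S.

Lemma eval1_linear (m : M) (f : Q) : linear (fun p => dual_app f p *: m).
Proof. by move=> a x y; rewrite dual_app_linear scalerDl -scalerA. Qed.

Definition eval1 (m : M) (f : Q) : hom_module rho M :=
  mk_linear (eval1_linear m f).

Lemma eval2_linear (m : M) : linear (eval1 m).
Proof.
by move=> a f g; apply: hom_ext => x; rewrite [LHS]scalerDl.
Qed.

Definition eval2 (m : M) : hom_module sigma (hom_module rho M) :=
  mk_linear (eval2_linear m).

Lemma eval_linear : linear eval2.
Proof.
move=> a m n; apply: hom_ext => f; apply: hom_ext => x.
by rewrite [LHS]scalerDr scalerA.
Qed.

(** Through the tensor-Hom adjunction the target is Hom_S(P ⊗_R Q, M), and this map is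
    precomposition with the trace pairing P ⊗_R Q -> S. *)
Definition eval : {linear M -> hom_module sigma (hom_module rho M)} :=
  mk_linear eval_linear.

Lemma eval_app m f x : hom_app (hom_app (eval m) f) x = dual_app f x *: m.
Proof. by []. Qed.

Definition eval_inv (h : hom_module sigma (hom_module rho M)) : M :=
  \sum_j hom_app (hom_app h (g_ j)) (q_ j).

Lemma evalK : cancel eval eval_inv.
Proof.
move=> m; rewrite /eval_inv -[RHS]scale1r -trace_one scaler_suml.
by apply: eq_bigr.
Qed.

(** Write f as the sum of f g_j(q_j) = [f, q_j] g_j. Linearity of h over [R] moves [f, q_j] to the
    argument x, giving h(g_j)(f(x) q_j) = f(x) h(g_j)(q_j). *)
Lemma eval_invK : cancel eval_inv eval.
Proof.
move=> h; apply: hom_ext => f; apply: hom_ext => x; rewrite eval_app.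
rewrite /eval_inv scaler_sumr.
transitivity (hom_app (hom_app h (act sigma 1 f)) x); last by rewrite act1.
transitivity (hom_app (hom_app h
    (\sum_j act sigma (dual_app (g_ j) (q_ j)) f)) x); last first.
  congr (hom_app (hom_app h _) x); rewrite -trace_one.
  apply: hom_ext => y; rewrite hom_app_suml [RHS]mulr_sumr.
  by apply: eq_bigr.
rewrite hom_app_sumr hom_app_suml; apply: eq_bigr => j _.
by rewrite -rank_one_scale hom_app_scale hom_appZ act_rank_one hom_app_scale.
Qed.

Lemma eval_iso : @is_iso (module_category S) _ _ eval.
Proof. exact: module_iso evalK eval_invK. Qed.

End Evaluation.

Section Coevaluation.
Variable N : lmodType R.

Lemma coeval1_linear (n : N) (p : P) : linear (fun f => rank_one f p *: n).
Proof.
by move=> a f g; rewrite rank_oneDl rank_oneZl scalerDl scalerA.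
Qed.

Definition coeval1 (n : N) (p : P) : hom_module sigma N :=
  mk_linear (coeval1_linear n p).

Lemma coeval2_linear (n : N) : linear (coeval1 n).
Proof.
move=> s p q; apply: hom_ext => f.
change (rank_one f (s *: p + q) *: n =
  rank_one (act sigma s f) p *: n + rank_one f q *: n).
by rewrite rank_oneDr rank_oneZr scalerDl.
Qed.

Definition coeval2 (n : N) : hom_module rho (hom_module sigma N) :=
  mk_linear (coeval2_linear n).

Lemma coeval_linear : linear coeval2.
Proof.
move=> a m n; apply: hom_ext => p; apply: hom_ext => f.
change (rank_one f p *: (a *: m + n) =
  rank_one f (act rho a p) *: m + rank_one f p *: n).
by rewrite rank_one_act scalerDr scalerA.
Qed.

(** The counterpart of [eval] for the pairing Q ⊗_S P -> R given by [rank_one]. *)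
Definition coeval : {linear N -> hom_module rho (hom_module sigma N)} :=
  mk_linear coeval_linear.

Lemma coeval_app n p f : hom_app (hom_app (coeval n) p) f = rank_one f p *: n.
Proof. by []. Qed.

Definition coeval_inv (h : hom_module rho (hom_module sigma N)) : N :=
  \sum_i hom_app (hom_app h (p_ i)) (f_ i).

Lemma coevalK : cancel coeval coeval_inv.
Proof.
move=> n; rewrite /coeval_inv -[RHS]scale1r -sum_rank_one scaler_suml.
by apply: eq_bigr.
Qed.

(** Expand p in the dual basis. The scalar f_i(p) passes to the argument f, where f f_i(p) = [f, p]
    f_i, and [f, p] comes out by linearity. *)
Lemma coeval_invK : cancel coeval_inv coeval.
Proof.
move=> h; apply: hom_ext => p; apply: hom_ext => f; rewrite coeval_app.
rewrite /coeval_inv scaler_sumr [in RHS](dual_basis p).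
rewrite hom_app_sumr hom_app_suml.
apply: eq_bigr => i _; rewrite [in RHS]hom_app_scale hom_appZ.
by rewrite -rank_one_scale hom_app_scale.
Qed.

Lemma coeval_iso : @is_iso (module_category R) _ _ coeval.
Proof. exact: module_iso coevalK coeval_invK. Qed.

End Coevaluation.

Theorem morita : equivalent_categories (module_category R) (module_category S).
Proof.
exists G, F; split; apply: naturally_isomorphic_sym.
  exists coeval; split=> [N|M N f]; first exact: coeval_iso.
  apply: linear_ext => n; apply: hom_ext => p; apply: hom_ext => g.
  by rewrite /hom_app /= linearZ.
exists eval; split=> [N|M N f]; first exact: eval_iso.
apply: linear_ext => n; apply: hom_ext => p; apply: hom_ext => g.
by rewrite /hom_app /= linearZ.
Qed.

End Morita.

(** * Projective generators with a finite endomorphism ring *)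

Local Open Scope quotient_scope.

(** * Quotient modules *)

Section QuotientModule.
Variables (R : pzRingType) (M : lmodType R) (T : {pred M}).
Hypothesis Tsub : submod_closed T.

(* The phantom argument carries the closure proof to canonical inference. *)
Definition submodule_pred of submod_closed T : {pred M} := T.
Local Notation N := (submodule_pred Tsub).

HB.instance Definition _ :=
  GRing.isZmodClosed.Build M N (GRing.submod_closedB Tsub).

Definition quotient_module : Type := Quotient.quot N.
Local Notation Q := quotient_module.
HB.instance Definition _ := GRing.Zmodule.on Q.

Definition quotient_proj (x : M) : Q := \pi_(Quotient.quot N) x.

Definition quotient_repr (u : Q) : M := repr (u : Quotient.quot N).

Lemma quotient_reprK : cancel quotient_repr quotient_proj.
Proof. by move=> u; apply: reprK. Qed.

Lemma quotient_proj_eq x y : quotient_proj x = quotient_proj y <-> x - y \in T.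
Proof.
by rewrite -[x - y \in T]/(x - y \in N) Quotient.idealrBE; split=> /eqP.
Qed.

Lemma quotient_projD x y :
  quotient_proj (x + y) = quotient_proj x + quotient_proj y.
Proof. exact: (raddfD (\pi_(Quotient.quot N))). Qed.

Definition quotient_scale (a : R) (u : Q) : Q :=
  quotient_proj (a *: quotient_repr u).

(** Scaling uses a chosen representative; two representatives differ by an element of [T], and [T]
    is closed under scaling. *)
Lemma quotient_projZ a x :
  quotient_proj (a *: x) = quotient_scale a (quotient_proj x).
Proof.
apply/quotient_proj_eq; rewrite -scalerBr.
have [T0 Tlin] := Tsub; rewrite -[X in X \in T]addr0; apply: Tlin => //.
by apply/quotient_proj_eq; rewrite quotient_reprK.
Qed.

Lemma quotient_scaleA a b u :
  quotient_scale a (quotient_scale b u) = quotient_scale (a * b) u.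
Proof. by rewrite -[u]quotient_reprK -!quotient_projZ scalerA. Qed.

Lemma quotient_scale1 : left_id 1 quotient_scale.
Proof. by move=> u; rewrite -[u]quotient_reprK -quotient_projZ scale1r. Qed.

Lemma quotient_scaleDr : right_distributive quotient_scale +%R.
Proof.
move=> a u v; rewrite -[u]quotient_reprK -[v]quotient_reprK.
by rewrite -quotient_projD -!quotient_projZ scalerDr quotient_projD.
Qed.

Lemma quotient_scaleDl u : {morph quotient_scale^~ u : a b / a + b}.
Proof.
move=> a b; rewrite -[u]quotient_reprK -!quotient_projZ scalerDl.
exact: quotient_projD.
Qed.

HB.instance Definition _ := GRing.Zmodule_isLmodule.Build R Q
  quotient_scaleA quotient_scale1 quotient_scaleDr quotient_scaleDl.

Lemma quotient_proj_linear : linear quotient_proj.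
Proof. by move=> a x y; rewrite quotient_projD quotient_projZ. Qed.

HB.instance Definition _ :=
  GRing.isLinear.Build R M Q *:%R quotient_proj quotient_proj_linear.

Lemma quotient_proj_eq0 x : quotient_proj x = 0 <-> x \in T.
Proof. by rewrite -(linear0 quotient_proj) quotient_proj_eq subr0. Qed.

End QuotientModule.

Definition is_epi (C : category) (X Y : ob C) (e : hom X Y) : Prop :=
  forall (Z : ob C) (g h : hom Y Z), compm g e = compm h e -> g = h.

Definition projective (C : category) (P : ob C) : Prop :=
  forall (X Y : ob C) (e : hom X Y), is_epi e ->
  forall h : hom P Y, exists k : hom P X, h = compm e k.

Definition generator (C : category) (P : ob C) : Prop :=
  forall (X Y : ob C) (f g : hom X Y),
    (forall h : hom P X, compm f h = compm g h) -> f = g.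

(** The uniqueness half of the universal property of a product. *)
Definition jointly_monic (C : category) (B Y : ob C) (p1 p2 : hom B Y) : Prop :=
  forall (W : ob C) (a b : hom W B),
    compm p1 a = compm p1 b -> compm p2 a = compm p2 b -> a = b.

(** * Epimorphisms of modules and the regular module *)

Section ModuleFacts.
Variable R : pzRingType.
Local Notation Mod := (module_category R).

Lemma lin_eq (M N : lmodType R) (f g : {linear M -> N}) : f = g -> f =1 g.
Proof. by move=> ->. Qed.

Lemma surj_epi (M N : lmodType R) (e : {linear M -> N}) :
  (forall y, exists x, e x = y) -> @is_epi Mod M N e.
Proof.
move=> es Z g h /= eq; apply: linear_ext => y.
by have [x <-] := es y; apply: (lin_eq eq x).
Qed.

Definition lin_image (M N : lmodType R) (e : {linear M -> N}) : {pred N} :=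
  fun y => `[< exists x, e x = y >].

Lemma lin_image_submod (M N : lmodType R) (e : {linear M -> N}) :
  submod_closed (lin_image e).
Proof.
split; first by apply/asboolP; exists 0; rewrite linear0.
move=> a _ _ /asboolP[x <-] /asboolP[y <-].
by apply/asboolP; exists (a *: x + y); rewrite linearP.
Qed.

(** The projection onto the cokernel and the zero map agree after [e], so they are equal and the
    cokernel vanishes. *)
Lemma epi_surj (M N : lmodType R) (e : {linear M -> N}) :
  @is_epi Mod M N e -> forall y, exists x, e x = y.
Proof.
move=> epi y; apply/asboolP/(quotient_proj_eq0 (lin_image_submod e)).
pose pi : {linear N -> quotient_module (lin_image_submod e)} :=
  @quotient_proj R N (lin_image e) (lin_image_submod e).
have /epi e0 : @compm Mod _ _ _ pi e = @compm Mod _ _ (quotient_module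
    (lin_image_submod e)) (\0 : {linear N -> quotient_module _}) e.
  apply: linear_ext => x.
  by apply/(quotient_proj_eq0 (lin_image_submod e))/asboolP; exists x.
exact: (lin_eq e0 y).
Qed.

Lemma from_regular_linear (M : lmodType R) (x : M) :
  linear (fun a : R^o => (a : R) *: x).
Proof. by move=> a b c; rewrite scalerDl -scalerA. Qed.

Definition from_regular (M : lmodType R) (x : M) : {linear R^o -> M} :=
  mk_linear (from_regular_linear x).

Lemma from_regularE (M : lmodType R) (f : {linear R^o -> M}) :
  f = from_regular (f 1).
Proof.
apply: linear_ext => a /=; rewrite -linearZ; congr (f _).
by rewrite -[LHS]mulr1.
Qed.

Lemma regular_projective : @projective Mod R^o.
Proof.
move=> X Y e /epi_surj es h; have [x xE] := es ((h : {linear R^o -> Y}) 1).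
exists (from_regular x); rewrite [LHS]from_regularE; apply: linear_ext => a /=.
by rewrite linearZ xE.
Qed.

Lemma regular_generator : @generator Mod R^o.
Proof.
move=> X Y f g fg; apply: linear_ext => x.
have := lin_eq (fg (from_regular x)) 1.
by rewrite /= scale1r.
Qed.

End ModuleFacts.

(** * A finite dual basis for a projective generator *)

Section FiniteRank.
Variables (R : finPzRingType) (S : pzRingType) (P : lmodType S).
Variable rho : raction R P.
Hypothesis act_inj : forall a b, act rho a =1 act rho b -> a = b.
Hypothesis act_surj : forall f : {linear P -> P}, exists a, act rho a =1 f.
Local Notation Q := (dual rho).

Definition in_trace : {pred S^o} := fun s =>
  `[< exists l : seq (Q * P), s = \sum_(u <- l) dual_app u.1 u.2 >].

Lemma in_trace_submod : submod_closed in_trace.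
Proof.
split; first by apply/asboolP; exists [::]; rewrite big_nil.
move=> a s t /asboolP[l ->] /asboolP[m ->]; apply/asboolP.
exists ([seq (u.1, a *: u.2) | u <- l] ++ m); rewrite big_cat big_map /=.
congr (_ + _); rewrite [LHS]mulr_sumr; apply: eq_bigr => u _.
by rewrite dual_appM.
Qed.

(* The projection [S -> S / tr P] kills every map from [P] to [S], so it is
   zero. *)
Lemma generator_trace : @generator (module_category S) P ->
  exists (n : nat) (g : 'I_n -> Q) (q : 'I_n -> P),
    \sum_j dual_app (g j) (q j) = 1.
Proof.
move=> gen; set S' := quotient_module in_trace_submod.
pose pi : {linear S^o -> S'} := @quotient_proj S S^o in_trace in_trace_submod.
have pi0 : pi = (\0 : {linear S^o -> S'}).
  apply: (gen S^o S') => h; apply: linear_ext => x.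
  apply/(quotient_proj_eq0 in_trace_submod)/asboolP.
  by exists [:: (h : Q, x)]; rewrite big_seq1.
have /(quotient_proj_eq0 in_trace_submod)/asboolP[l lE] := lin_eq pi0 1.
exists (size l), (fun j => (tnth (in_tuple l) j).1).
exists (fun j => (tnth (in_tuple l) j).2).
by rewrite -(big_tnth _ _ l xpredT (fun u => dual_app u.1 u.2)) -lE.
Qed.

(** Multiply 1 = sum_j g_j(q_j) by x: the summand g_j(q_j) x is the image of q_j under [g_j, x]. The
    coefficients form a finite type because [R] is finite. *)
Lemma trace_finitely_generated n (g : 'I_n -> Q) (q : 'I_n -> P) :
  \sum_j dual_app (g j) (q j) = 1 ->
  forall x, exists r : {ffun 'I_n -> R}, x = \sum_j act rho (r j) (q j).
Proof.
move=> tr x; exists [ffun j => rank_one act_surj (g j) x].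
rewrite -[LHS]scale1r -tr scaler_suml; apply: eq_bigr => j _.
by rewrite ffunE act_rank_one.
Qed.

Lemma combination_linear (I : finType) (p : I -> P) :
  linear (fun u : {ffun I -> S^o} => \sum_i (u i : S) *: p i).
Proof.
move=> a u v; rewrite scaler_sumr -big_split; apply: eq_bigr => i _.
by rewrite !ffunE scalerDl -scalerA.
Qed.

Lemma coordinate_linear (I : finType) (h : {linear P -> {ffun I -> S^o}}) i :
  linear (fun x => h x i : S^o).
Proof. by move=> a x y; rewrite linearP !ffunE. Qed.

(** The finite family [p] lists all of [P], so the free module on [I] maps onto [P]. Projectivity
    splits this map, and the coordinates of the splitting are the dual basis. *)
Lemma projective_dual_basis (I : finType) (p : I -> P) :
  @projective (module_category S) P ->
  (forall x, exists i, x = p i) ->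
  exists f : I -> Q, forall x : P, x = \sum_i dual_app (f i) x *: p i.
Proof.
move=> proj ps; pose e := mk_linear (combination_linear p).
have epi : @is_epi (module_category S) _ _ e.
  apply: surj_epi => x; have [i ->] := ps x.
  exists [ffun j => (j == i)%:R]; rewrite /= (bigD1 i) //= ffunE eqxx scale1r.
  by rewrite big1 ?addr0 // => j /negbTE ji; rewrite ffunE ji scale0r.
have [h hE] := proj _ _ e epi (lin_id P).
exists (fun i => mk_linear (coordinate_linear h i)) => x.
exact: (lin_eq hE x).
Qed.

Lemma finite_morita : @projective (module_category S) P ->
  @generator (module_category S) P ->
  equivalent_categories (module_category R) (module_category S).
Proof.
move=> proj /generator_trace[n [g [q tr]]].
(* The finite set of coefficient vectors enumerates all of [P], possibly with repetitions, and
   becomes the index set of the dual basis. *)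
pose p (r : {ffun 'I_n -> R}) := \sum_j act rho (r j) (q j).
have [f fE] := projective_dual_basis proj
  (trace_finitely_generated tr : forall x, exists r, x = p r).
exact: (morita act_inj act_surj fE tr).
Qed.

End FiniteRank.

(* [f] is an anti-isomorphism from [R] onto the endomorphism monoid of [P].
   Additivity is expressed through the codiagonal [s] on the biproduct [B]. *)
Definition is_model (R : finPzRingType) (C : category) (P B : ob C)
    (p1 p2 s : hom B P) (f : R -> hom P P) : Prop :=
  [/\ projective P, generator P, jointly_monic p1 p2 &
  [/\ forall a b, f (a * b) = compm (f b) (f a),
      forall a b, exists m : hom P B,
        [/\ compm p1 m = f a, compm p2 m = f b & compm s m = f (a + b)],
      forall a b, a <> b -> f a <> f b &
      forall g, exists a, g = f a]].

Definition has_model (R : finPzRingType) (C : category) : Prop :=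
  exists (P B : ob C) (p1 p2 s : hom B P) (f : R -> hom P P),
    is_model p1 p2 s f.

Section Model.
Variables (R : finPzRingType).

(** Take P = R, B = R + R with its projections, addition for the codiagonal, and right
    multiplication by a for f(a). *)
Lemma model_self : has_model R (module_category R).
Proof.
pose p1 : {linear (R^o * R^o)%type -> R^o} := fst.
pose p2 : {linear (R^o * R^o)%type -> R^o} := snd.
have sl : linear (fun x : R^o * R^o => x.1 + x.2).
  by move=> a x y; rewrite /= scalerDr addrACA.
exists (R^o : lmodType R), ((R^o * R^o)%type : lmodType R), p1, p2,
  (mk_linear sl), (@from_regular R R^o).
split.
- exact: regular_projective.
- exact: regular_generator.
- move=> W a b e1 e2; apply: linear_ext => x.
  by rewrite [LHS]surjective_pairing [RHS]surjective_pairing; congr (_, _);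
    [apply: (lin_eq e1 x) | apply: (lin_eq e2 x)].
split.
- by move=> a b; apply: linear_ext => x /=; apply: mulrA.
- move=> a b; exists (from_regular ((a, b) : R^o * R^o)).
  split; apply: linear_ext => x //=.
  by rewrite [RHS]mulrDr.
- by move=> a b ab /lin_eq/(_ 1) /=; rewrite !scale1r.
- by move=> g; exists ((g : {linear R^o -> R^o}) 1); apply: from_regularE.
Qed.

Lemma model_equivalent (S : pzRingType) : has_model R (module_category S) ->
  equivalent_categories (module_category R) (module_category S).
Proof.
case=> P [B [p1 [p2 [s [f [proj gen mono [fM fD finj fsurj]]]]]]].
pose fx a : {linear P -> P} := f a.
have fxM a b x : fx (a * b) x = fx b (fx a x) by exact: (lin_eq (fM a b) x).
(* The identity is f(a) for some a, and f(1) = f(1) f(a) = f(a 1) = f(a). *)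
have f1 x : fx 1 x = x.
  have [a aE] := fsurj (lin_id P).
  have faE y : fx a y = y by rewrite /fx -aE.
  by rewrite -{1}[x]faE -fxM mulr1 faE.
have f0 x : fx 0 x = 0.
  have [a aE] := fsurj (\0 : {linear P -> P}).
  have faE y : fx a y = 0 by rewrite /fx -aE.
  by rewrite -(mulr0 a) fxM faE linear0.
have fxD a b x : fx (a + b) x = fx a x + fx b x.
  have [i [/lin_eq i1 /lin_eq i2 /lin_eq i3]] := fD 1 0.
  have [j [/lin_eq j1 /lin_eq j2 /lin_eq j3]] := fD 0 1.
  have [m [/lin_eq m1 /lin_eq m2 /lin_eq m3]] := fD a b.
  pose m' : {linear P -> B} := lin_comp i (f a) \+ lin_comp j (f b).
  have mE : m = m'.
    apply: mono; apply: linear_ext => y; rewrite ?[LHS]m1 ?[LHS]m2 /= linearD.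
      by rewrite [X in X + _]i1 [X in _ + X]j1 [X in X + _]f1 [X in _ + X]f0
        addr0.
    by rewrite [X in X + _]i2 [X in _ + X]j2 [X in X + _]f0 [X in _ + X]f1
      add0r.
  rewrite -[LHS]m3 mE /= linearD [X in X + _]i3 [X in _ + X]j3 addr0 add0r.
  by rewrite -[X in X + _]/(fx 1 _) -[X in _ + X]/(fx 1 _) !f1.
pose rho := Raction f1 fxM fxD.
apply: (@finite_morita R S P rho) => //.
- move=> a b /linear_ext ab; apply: contrapT => /finj; exact.
- by move=> g; have [a ->] := fsurj g; exists a.
Qed.

End Model.

Local Close Scope quotient_scope.
Local Close Scope ring_scope.

(** * The sentence describing a projective generator *)

Section Combinators.
Variables (A B : Type).

Definition comp_eq (g f h k : B) : formula A B :=
  ExMor (And (IsComp A None (Some g) (Some f))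
             (IsComp A None (Some h) (Some k))).

Definition all_hom (x y : A) (phi : formula A (option B)) : formula A B :=
  AllMor (Imp (InMor None x y) phi).

Definition ex_hom (x y : A) (phi : formula A (option B)) : formula A B :=
  ExMor (And (InMor None x y) phi).

Definition true_formula : formula A B := AllOb (EqOb _ None None).

Definition big_and (T : finType) (phi : T -> formula A B) : formula A B :=
  foldr (fun t psi => And (phi t) psi) true_formula (enum T).

Definition big_or (T : finType) (phi : T -> formula A B) : formula A B :=
  foldr (fun t psi => Or (phi t) psi) (Neg true_formula) (enum T).

Variables (C : category) (eo : A -> ob C) (em : B -> mor C).

Lemma sat_comp_eq (g f h k : B) (W X Y Z : ob C)
    (u : hom X Z) (v : hom W X) (u' : hom Y Z) (v' : hom W Y) :
  em g = Mor u -> em f = Mor v -> em h = Mor u' -> em k = Mor v' ->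
  sat (comp_eq g f h k) eo em = (compm u v = compm u' v').
Proof.
move=> gE fE hE kE; apply/propext.
have c1 w w' (wE : w = Mor w') := @sat_IsComp C A _ eo (extend em w)
  None (Some g) (Some f) _ _ _ _ _ _ wE gE fE.
have c2 w w' (wE : w = Mor w') := @sat_IsComp C A _ eo (extend em w)
  None (Some h) (Some k) _ _ _ _ _ _ wE hE kE.
split=> [[w [s1 s2]]|uv]; last first.
  by exists (Mor (compm u v)); split; [apply/c1 | apply/c2].
case: (@sat_IsComp_typed C A _ eo (extend em w) None (Some g) (Some f) s1).
rewrite /= gE fE /= => wW _ wZ; have /MorP[w' wE] := conj wW wZ.
by move/(c1 w w' wE): s1 => <-; apply/(c2 w w' wE).
Qed.

Lemma sat_EqMor (f g : B) (X Y : ob C) (u v : hom X Y) :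
  em f = Mor u -> em g = Mor v -> sat (EqMor A f g) eo em = (u = v).
Proof.
move=> /= -> ->; apply/propext; split=> [|->//]; exact: Mor_inj.
Qed.

Lemma sat_IsCompE (h f g : B) (X Y Z : ob C) (u : hom Y Z) (v : hom X Y)
    (w : hom X Z) :
  em h = Mor w -> em f = Mor u -> em g = Mor v ->
  sat (IsComp A h f g) eo em = (w = compm u v).
Proof. by move=> hE fE gE; apply/propext/sat_IsComp. Qed.

Lemma sat_AllOb (phi : formula (option A) B) :
  sat (AllOb phi) eo em = forall X : ob C, sat phi (extend eo X) em.
Proof. by []. Qed.

Lemma sat_Imp (phi psi : formula A B) :
  sat (Imp phi psi) eo em = (sat phi eo em -> sat psi eo em).
Proof. by []. Qed.

Lemma sat_And (phi psi : formula A B) :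
  sat (And phi psi) eo em = (sat phi eo em /\ sat psi eo em).
Proof. by []. Qed.

Lemma sat_Neg (phi : formula A B) : sat (Neg phi) eo em = ~ sat phi eo em.
Proof. by []. Qed.

Lemma sat_all_hom x y (phi : formula A (option B)) :
  sat (all_hom x y phi) eo em =
  forall u : hom (eo x) (eo y), sat phi eo (extend em (Mor u)).
Proof.
by apply/propext; split=> /= [h u|h _ [u ->]]; apply: h; exists u.
Qed.

Lemma sat_ex_hom x y (phi : formula A (option B)) :
  sat (ex_hom x y phi) eo em =
  exists u : hom (eo x) (eo y), sat phi eo (extend em (Mor u)).
Proof.
apply/propext; split=> /= [[_ [[u ->] h]]|[u h]]; first by exists u.
by exists (Mor u); split=> //; exists u.
Qed.

Lemma sat_big_and (T : finType) (phi : T -> formula A B) :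
  sat (big_and phi) eo em = forall t, sat (phi t) eo em.
Proof.
apply/propext; rewrite /big_and.
have -> : (forall t, sat (phi t) eo em) <->
    (forall t, t \in enum T -> sat (phi t) eo em).
  by split=> h t *; apply: h; rewrite mem_enum.
elim: (enum T) => [|t s IH] /=; first by split.
split=> [[ht /IH hs] t'|h]; first by rewrite inE => /orP[/eqP->|/hs].
split; first by apply: h; rewrite mem_head.
by apply/IH => t' ts; apply: h; rewrite inE ts orbT.
Qed.

Lemma sat_big_or (T : finType) (phi : T -> formula A B) :
  sat (big_or phi) eo em = exists t, sat (phi t) eo em.
Proof.
apply/propext; rewrite /big_or.
have -> : (exists t, sat (phi t) eo em) <->
    (exists2 t, t \in enum T & sat (phi t) eo em).
  by split=> [[t]|[t _]]; exists t => //; rewrite mem_enum.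
elim: (enum T) => [|t s IH] /=; first by split=> [[]|[]].
split=> [[ht|/IH[t' ts ht]]|[t' + ht]].
- by exists t; rewrite ?mem_head.
- by exists t'; rewrite // inE ts orbT.
- by rewrite inE => /orP[/eqP <-|ts]; [left | right; apply/IH; exists t'].
Qed.

End Combinators.

Section Families.

Fixpoint opt_iter (n : nat) : finType :=
  if n is n'.+1 then option (opt_iter n') else void.

Lemma card_opt_iter n : #|opt_iter n| = n.
Proof. by elim: n => [|n IH]; rewrite ?card_void // card_option IH. Qed.

Fixpoint ex_mors (A : Type) (n : nat) :
    formula A (opt_iter n) -> formula A void :=
  if n is n'.+1 then fun phi => ex_mors (ExMor phi : formula A (opt_iter n'))
  else id.

Lemma sat_ex_mors (A : Type) (n : nat) (phi : formula A (opt_iter n))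
    (C : category) (eo : A -> ob C) (em0 : void -> mor C) :
  sat (ex_mors phi) eo em0 <-> exists em : opt_iter n -> mor C, sat phi eo em.
Proof.
elim: n phi => [|n IH] phi /=.
  split=> [h|[em]]; first by exists em0.
  by have -> : em = em0 by apply/funext => -[].
rewrite IH /=; split=> [[em [f h]]|[em h]]; first by exists (extend em f).
exists (fun b => em (Some b)), (em None).
suff -> : extend (fun b => em (Some b)) (em None) = em by [].
by apply/funext => -[].
Qed.

Definition opt_index (T : finType) (t : T) : opt_iter #|T| :=
  enum_val (cast_ord (esym (card_opt_iter #|T|)) (enum_rank t)).

Lemma opt_index_can (T : finType) : exists w, cancel (@opt_index T) w.
Proof.
exists (fun b => enum_val (cast_ord (card_opt_iter #|T|) (enum_rank b))) => t.
by rewrite /opt_index enum_valK cast_ordKV enum_rankK.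
Qed.

Definition ex_family (A : Type) (T : finType)
    (phi : forall B, (T -> B) -> formula A B) : formula A void :=
  ex_mors (phi (opt_iter #|T|) (@opt_index T)).

Lemma sat_ex_family (A : Type) (T : finType)
    (phi : forall B, (T -> B) -> formula A B)
    (C : category) (eo : A -> ob C) (sem : (T -> mor C) -> Prop) :
  (forall B (v : T -> B) em, sat (phi B v) eo em = sem (fun t => em (v t))) ->
  forall em0, sat (ex_family phi) eo em0 <-> exists fam : T -> mor C, sem fam.
Proof.
move=> phiE em0; rewrite /ex_family sat_ex_mors.
have [w wK] := opt_index_can T; split=> [[em]|[fam h]].
  by rewrite phiE; exists (fun t => em (opt_index t)).
exists (fun b => fam (w b)); rewrite phiE.
suff -> : (fun t => fam (w (opt_index t))) = fam by [].
by apply/funext => t; rewrite wK.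
Qed.

End Families.

Section Formulas.
Variables (A B : Type).

Definition epi_formula (y : A) (e : B) : formula A B :=
  AllOb (all_hom (Some y) None (all_hom (Some y) None
    (Imp (comp_eq _ (Some None) (Some (Some e)) None (Some (Some e)))
      (EqMor _ (Some None) None)))).

Definition generator_formula (p : A) : formula A B :=
  AllOb (AllOb (all_hom (Some None) None (all_hom (Some None) None
    (Imp (all_hom (Some (Some p)) (Some None)
        (comp_eq _ (Some (Some None)) None (Some None) None))
      (EqMor _ (Some None) None))))).

Definition jointly_monic_formula (b : A) (p1 p2 : B) : formula A B :=
  AllOb (all_hom None (Some b) (all_hom None (Some b)
    (Imp (comp_eq _ (Some (Some p1)) (Some None) (Some (Some p1)) None)
    (Imp (comp_eq _ (Some (Some p2)) (Some None) (Some (Some p2)) None)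
      (EqMor _ (Some None) None))))).

End Formulas.

Definition projective_formula (A B : Type) (p : A) : formula A B :=
  AllOb (AllOb (all_hom (Some None) None
    (Imp (epi_formula None None)
      (all_hom (Some (Some p)) None (ex_hom (Some (Some p)) (Some None)
        (IsComp _ (Some None) (Some (Some None)) None)))))).

Lemma eq_imp (P P' Q Q' : Prop) : P = P' -> Q = Q' -> (P -> Q) = (P' -> Q').
Proof. by move=> -> ->. Qed.

Section FormulasSat.
Variables (A B : Type) (C : category) (eo : A -> ob C) (em : B -> mor C).

Lemma sat_epi (y : A) (e : B) (X : ob C) (u : hom X (eo y)) :
  em e = Mor u -> sat (epi_formula y e) eo em = is_epi u.
Proof.
move=> eE; rewrite sat_AllOb; apply: eq_forall => Z.
rewrite sat_all_hom; apply: eq_forall => g.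
rewrite sat_all_hom; apply: eq_forall => h.
by rewrite sat_Imp; apply: eq_imp; [apply: sat_comp_eq | apply: sat_EqMor].
Qed.

Lemma sat_generator (p : A) :
  sat (generator_formula B p) eo em = generator (eo p).
Proof.
rewrite sat_AllOb; apply: eq_forall => X.
rewrite sat_AllOb; apply: eq_forall => Y.
rewrite sat_all_hom; apply: eq_forall => f.
rewrite sat_all_hom; apply: eq_forall => g.
rewrite sat_Imp; apply: eq_imp; last exact: sat_EqMor.
by rewrite sat_all_hom; apply: eq_forall => h; apply: sat_comp_eq.
Qed.

Lemma sat_jointly_monic (b : A) (p1 p2 : B) (Y : ob C) (u1 u2 : hom (eo b) Y) :
  em p1 = Mor u1 -> em p2 = Mor u2 ->
  sat (jointly_monic_formula b p1 p2) eo em = jointly_monic u1 u2.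
Proof.
move=> e1 e2; rewrite sat_AllOb; apply: eq_forall => W.
rewrite sat_all_hom; apply: eq_forall => f.
rewrite sat_all_hom; apply: eq_forall => g.
do 2 (rewrite sat_Imp; apply: eq_imp; first by apply: sat_comp_eq).
exact: sat_EqMor.
Qed.

End FormulasSat.

Lemma sat_projective (A B : Type) (C : category) (eo : A -> ob C)
    (em : B -> mor C) (p : A) :
  sat (projective_formula B p) eo em = projective (eo p).
Proof.
rewrite sat_AllOb; apply: eq_forall => X.
rewrite sat_AllOb; apply: eq_forall => Y.
rewrite sat_all_hom; apply: eq_forall => e.
rewrite sat_Imp; apply: eq_imp; first exact: sat_epi.
rewrite sat_all_hom; apply: eq_forall => h.
rewrite sat_ex_hom; apply: eq_exists => k.
exact: sat_IsCompE.
Qed.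

Section ModelFormula.
Variable R : finPzRingType.

Definition typing_formula (A B : Type) (p b : A) (p1 p2 s : B) (f : R -> B) :
  formula A B :=
  And (And (InMor p1 b p) (And (InMor p2 b p) (InMor s b p)))
    (big_and (fun a => InMor (f a) p p)).

Definition model_formula (A B : Type) (p b : A) (p1 p2 s : B) (f : R -> B) :
  formula A B :=
  And (And (projective_formula B p)
    (And (generator_formula B p) (jointly_monic_formula b p1 p2)))
  (And (And (big_and (fun a => big_and (fun a' =>
         IsComp _ (f (a * a')%R) (f a') (f a))))
       (big_and (fun a => big_and (fun a' => ex_hom p b
         (And (IsComp _ (Some (f a)) (Some p1) None)
         (And (IsComp _ (Some (f a')) (Some p2) None)
              (IsComp _ (Some (f (a + a')%R)) (Some s) None)))))))
  (And (big_and (fun a => big_and (fun a' =>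
         if a == a' then true_formula A B else Neg (EqMor _ (f a) (f a')))))
       (all_hom p p (big_or (fun a => EqMor _ None (Some (f a))))))).

Lemma sat_model (A B : Type) (C : category) (eo : A -> ob C) (em : B -> mor C)
    (p b : A) (p1 p2 s : B) (f : R -> B) (u1 u2 us : hom (eo b) (eo p))
    (fu : R -> hom (eo p) (eo p)) :
  em p1 = Mor u1 -> em p2 = Mor u2 -> em s = Mor us ->
  (forall a, em (f a) = Mor (fu a)) ->
  sat (model_formula p b p1 p2 s f) eo em <-> is_model u1 u2 us fu.
Proof.
move=> e1 e2 es ef; rewrite /model_formula !sat_And.
rewrite sat_projective sat_generator (sat_jointly_monic (eo := eo) e1 e2).
rewrite !sat_big_and sat_all_hom.
have -> : (forall a, sat (big_and (fun a' =>
    IsComp A (f (a * a')%R) (f a') (f a))) eo em) =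
    forall a a', fu (a * a')%R = compm (fu a') (fu a).
  apply: eq_forall => a; rewrite sat_big_and; apply: eq_forall => a'.
  exact: sat_IsCompE.
have -> : (forall a, sat (big_and (fun a' => ex_hom p b
    (And (IsComp A (Some (f a)) (Some p1) None)
    (And (IsComp A (Some (f a')) (Some p2) None)
         (IsComp A (Some (f (a + a')%R)) (Some s) None))))) eo em) =
    forall a a', exists m : hom (eo p) (eo b),
      [/\ compm u1 m = fu a, compm u2 m = fu a' & compm us m = fu (a + a')%R].
  apply: eq_forall => a; rewrite sat_big_and; apply: eq_forall => a'.
  rewrite sat_ex_hom; apply: eq_exists => m; rewrite !sat_And.
  rewrite (@sat_IsCompE _ _ _ _ (extend em (Mor m)) (Some (f a)) (Some p1) None
    _ _ _ u1 m (fu a) (ef a) e1 erefl).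
  rewrite (@sat_IsCompE _ _ _ _ (extend em (Mor m)) (Some (f a')) (Some p2) None
    _ _ _ u2 m (fu a') (ef a') e2 erefl).
  rewrite (@sat_IsCompE _ _ _ _ (extend em (Mor m)) (Some (f (a + a')%R))
    (Some s) None _ _ _ us m (fu (a + a')%R) (ef (a + a')%R) es erefl).
  by apply/propext; split=> [[? [? ?]]|[? ? ?]]; repeat split.
have -> : (forall a, sat (big_and (fun a' => if a == a' then true_formula A B
      else Neg (EqMor A (f a) (f a')))) eo em) =
    forall a a', a <> a' -> fu a <> fu a'.
  apply: eq_forall => a; rewrite sat_big_and; apply: eq_forall => a'.
  case: eqP => [aa'|naa']; first by apply/propext; split.
  rewrite sat_Neg (@sat_EqMor _ _ _ _ _ _ _ _ _ (fu a) (fu a') (ef a) (ef a')).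
  by apply/propext; split=> [h _|]; last exact.
have -> : (forall u : hom (eo p) (eo p),
    sat (big_or (fun a => EqMor A None (Some (f a)))) eo (extend em (Mor u))) =
    forall g, exists a, g = fu a.
  apply: eq_forall => g; rewrite sat_big_or; apply: eq_exists => a.
  exact: (@sat_EqMor _ _ _ eo (extend em (Mor g)) None (Some (f a)) _ _ g (fu a)
    erefl (ef a)).
by split=> [[[? [? ?]] [[? ?] [? ?]]]|[? ? ? [? ? ? ?]]]; repeat split.
Qed.

Lemma sat_typing (A B : Type) (C : category) (eo : A -> ob C) (em : B -> mor C)
    (p b : A) (p1 p2 s : B) (f : R -> B) :
  sat (typing_formula p b p1 p2 s f) eo em <->
  exists (u1 u2 us : hom (eo b) (eo p)) (fu : R -> hom (eo p) (eo p)),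
    [/\ em p1 = Mor u1, em p2 = Mor u2, em s = Mor us &
      forall a, em (f a) = Mor (fu a)].
Proof.
rewrite /typing_formula !sat_And sat_big_and; split; last first.
  case=> u1 [u2 [us [fu [e1 e2 es ef]]]]; split.
    by split; [exists u1 | split; [exists u2 | exists us]].
  by move=> a; exists (fu a).
case=> [[[u1 e1] [[u2 e2] [us es]]] /= ef].
by exists u1, u2, us, (fun a => projT1 (cid (ef a))); split=> // a; case: cid.
Qed.

Definition model_family (B : Type) (v : option (option (option R)) -> B) :
    formula (option (option void)) B :=
  let f a := v (Some (Some (Some a))) in
  And (typing_formula (Some None) None
         (v None) (v (Some None)) (v (Some (Some None))) f)
      (model_formula (Some None) None
         (v None) (v (Some None)) (v (Some (Some None))) f).

Definition model_sentence : sentence :=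
  ExOb (ExOb (ex_family model_family)).

Lemma holds_model_sentence (C : category) :
  holds C model_sentence <-> has_model R C.
Proof.
pose eo P Q : option (option void) -> ob C :=
  extend (extend (of_void (ob C)) P) Q.
pose sem P Q (em : option (option (option R)) -> mor C) :=
  exists (u1 u2 us : hom Q P) (fu : R -> hom P P),
    [/\ em None = Mor u1, em (Some None) = Mor u2,
        em (Some (Some None)) = Mor us
      & forall a, em (Some (Some (Some a))) = Mor (fu a)] /\
    is_model u1 u2 us fu.
suff famE P Q : sat (ex_family model_family) (eo P Q) (of_void (mor C)) <->
    exists em, sem P Q em.
  split=> [[P [Q /famE[em [u1 [u2 [us [fu [_ m]]]]]]]]|].
    by exists P, Q, u1, u2, us, fu.
  case=> P [Q [u1 [u2 [us [fu m]]]]]; exists P, Q; apply/famE.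
  exists (fun t => match t with
    | None => Mor u1 | Some None => Mor u2 | Some (Some None) => Mor us
    | Some (Some (Some a)) => Mor (fu a) end).
  by exists u1, u2, us, fu.
apply: sat_ex_family => B v em; apply/propext; rewrite sat_And sat_typing.
have modelE := @sat_model _ _ _ (eo P Q) em (Some None) None.
split=> [[[u1 [u2 [us [fu [e1 e2 es ef]]]]]]|
  [u1 [u2 [us [fu [[e1 e2 es ef]]]]]]].
  by move/(modelE _ _ _ _ u1 u2 us fu e1 e2 es ef); exists u1, u2, us, fu.
move=> m; split; first by exists u1, u2, us, fu.
exact/(modelE _ _ _ _ u1 u2 us fu e1 e2 es ef).
Qed.

End ModelFormula.

Theorem mainTheorem20 (R : finPzRingType) (S : pzRingType) :
  elementarily_equivalent (module_category R) (module_category S) <->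
  equivalent_categories (module_category R) (module_category S).
Proof.
split=> [RS|]; last first.
  by apply: equivalent_elementarily_equivalent; apply: module_category_roomy.
apply/model_equivalent/holds_model_sentence/RS/holds_model_sentence.
exact: model_self.
Qed.
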